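(* Let $f$ be a face with $\dim f \ge 1$, let $s \in \{0,1\}^{D+1}$ with $\operatorname{supp}(s) = f$, and let $k \in f$. Then $$\psi(\xi; f,k,s) = -\sum_{v \in f\setminus k} \psi(\xi; f,v,s).$$ Additionally, every summand in the right-hand side is anchored when $k = \min f$.
   Context: $D \ge 1$ is an integer and $\Delta_\xi$ is a non-degenerate $D$-simplex in $\mathbb{R}^D$ with vertex labels $0,\dots,D$, naturally ordered, and barycentric coordinates $\xi_0,\dots,\xi_D$ (affine functions with value $\delta_{ij}$ at vertices). A face is identified with its label set $f \subseteq\{0,\dots,D\}$; $\dim f = |f|-1$, $\min f$ is the smallest label, $f\setminus k$ means $f\setminus\{k\}$. For $s \in \{0,1\}^{D+1}$, $|s| = \sum_i s_i$ and $\operatorname{supp}(s) = \{i : s_i > 0\}$. For a face $f$ with $\dim f\ge 1$, $k\in f$ and $s\in\{0,1\}^{D+1}$ with $\operatorname{supp}(s)\cup\{k\} = f$, the directional 1-form is $\psi(\xi; f,k,s) = \mathrm{d}\xi_k - \frac{s_k}{|s|}\sum_{j\in f}\mathrm{d}\xi_j$. It (that is, its argument $(f,k,s)$) is called anchored if $s_i = 0$ for all $i < \min(f\setminus k)$. *)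

(* Defs.v *)
From HB Require Import structures.
From mathcomp Require Import all_boot all_order all_algebra.
From mathcomp Require Import functions reals topology normedtype derive.

Set Implicit Arguments.
Unset Strict Implicit.
Unset Printing Implicit Defensive.

Import Order.TTheory GRing.Theory Num.Theory.
Import numFieldNormedType.Exports.
Local Open Scope ring_scope.

(* A 1-form is a function of the base point and of the tangent vector; the
   algebraic operations on 1-forms are the pointwise ones. *)
Notation one_form R D := ('rV[R]_D -> 'rV[R]_D -> R).

Section Simplex.
Variables (R : realType) (D : nat).

(* Non-degeneracy: the edge vectors issuing from vertex 0 are linearly
   independent. *)
Definition nondegenerate_simplex (p : 'I_D.+1 -> 'rV[R]_D) : Prop :=
  row_free (\matrix_(i < D) (p (lift ord0 i) - p ord0)).

Definition affine_fun (g : 'rV[R]_D -> R) : Prop :=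
  exists (l : {scalar 'rV[R]_D}) (b : R), forall x, g x = l x + b.

Definition barycentric (p : 'I_D.+1 -> 'rV[R]_D)
    (xi : 'I_D.+1 -> 'rV[R]_D -> R) : Prop :=
  (forall i, affine_fun (xi i)) /\ (forall i j, xi i (p j) = (i == j)%:R).

Definition dform (g : 'rV[R]_D -> R) : one_form R D := fun x => 'd g x.

End Simplex.

Section Faces.
Variable D : nat.
Implicit Types (f : {set 'I_D.+1}) (k : 'I_D.+1) (s : {ffun 'I_D.+1 -> bool}).

Definition face_dim f : nat := #|f|.-1.

(* Only meaningful for a nonempty f: the value on set0 is the largest label. *)
Definition min_label f : 'I_D.+1 := \big[Order.min/ord_max]_(i in f) i.

Definition weight s : nat := (\sum_i s i)%N.

Definition supp s : {set 'I_D.+1} := [set i | (0 < s i)%N].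

(* The triples (f, k, s) for which the form psi below is considered. *)
Definition directional f k s : Prop :=
  [/\ (1 <= face_dim f)%N, k \in f & supp s :|: [set k] = f].

Definition anchored f k s : Prop :=
  directional f k s /\
  forall i : 'I_D.+1, (i < min_label (f :\ k))%N -> s i = false.

End Faces.

Definition psi (R : realType) (D : nat) (xi : 'I_D.+1 -> 'rV[R]_D -> R)
    (f : {set 'I_D.+1}) (k : 'I_D.+1) (s : {ffun 'I_D.+1 -> bool}) :
    one_form R D :=
  dform (xi k)
    - ((s k)%:R / (weight s)%:R) *: \sum_(j in f) dform (xi j).

(* Main.v *)
Require Import Defs.
From HB Require Import structures.
From mathcomp Require Import all_boot all_order all_algebra.
From mathcomp Require Import functions reals topology normedtype derive.

Import Order.TTheory GRing.Theory Num.Theory.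
Import numFieldNormedType.Exports.
Local Open Scope ring_scope.

(** Since [supp s = f], the coefficients [s_v / |s|] add up to 1 over [f], so the forms
    [psi xi f v s], [v] in [f], cancel in total ([sum_psi_eq0]); isolating the term at [k] gives the
    identity. If [k] is the least label of [f], removing another [v] keeps [k], so every label below
    the minimum of [f :\ v] lies outside [f], where [s] vanishes. *)

Lemma min_label_le (D : nat) (f : {set 'I_D.+1}) (i : 'I_D.+1) :
  i \in f -> (min_label f <= i)%N.
Proof. exact: (@bigmin_le_cond _ _ _ ord_max i (mem f) id). Qed.

Lemma weight_sum_supp (D : nat) (s : {ffun 'I_D.+1 -> bool}) :
  weight s = (\sum_(i in supp s) s i)%N.
Proof.
rewrite /weight [RHS]big_mkcond; apply: eq_bigr => i _.
by rewrite inE; case: (s i).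
Qed.

Lemma sum_psi_eq0 (R : realType) (D : nat) (xi : 'I_D.+1 -> 'rV[R]_D -> R)
    (s : {ffun 'I_D.+1 -> bool}) :
  weight s != 0%N -> \sum_(v in supp s) psi xi (supp s) v s = 0.
Proof.
(* The subtracted sum of differentials does not depend on [v], so it factors out with total
   coefficient [|s| / |s|]. *)
move=> s_neq0; rewrite /psi sumrB -scaler_suml -mulr_suml -natr_sum.
by rewrite -weight_sum_supp divff ?pnatr_eq0// scale1r subrr.
Qed.

Theorem lemma2 (R : realType) (D : nat) (D_ge1 : (1 <= D)%N)
    (p : 'I_D.+1 -> 'rV[R]_D) (p_nondeg : nondegenerate_simplex p)
    (xi : 'I_D.+1 -> 'rV[R]_D -> R) (xi_bary : barycentric p xi)
    (f : {set 'I_D.+1}) (dim_f : (1 <= face_dim f)%N)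
    (s : {ffun 'I_D.+1 -> bool}) (supp_s : supp s = f)
    (k : 'I_D.+1) (k_f : k \in f) :
  psi xi f k s = - (\sum_(v in f :\ k) psi xi f v s)
  /\ (k = min_label f -> forall v : 'I_D.+1, v \in f :\ k -> anchored f v s).
Proof.
have s_f i : (i \in f) = s i by rewrite -supp_s inE; case: (s i).
split=> [|k_min v].
  (* The label [k] alone already contributes 1 to the weight. *)
  have s_neq0 : weight s != 0%N by rewrite /weight (bigD1 k)//= -s_f k_f.
  have := sum_psi_eq0 R D xi s s_neq0.
  by rewrite supp_s (big_setD1 k)//= => /addr0_eq <-; rewrite opprK.
rewrite !inE => /andP[v_neq_k v_f]; split.
  by split=> //; rewrite supp_s setUC; apply/setUidPr; rewrite sub1set.
(* If [s i] holds then [i] is in [f], whence [min (f :\ v) <= k = min f <= i]. *)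
move=> i lt_i; apply: contraTF lt_i => s_i; rewrite -leqNgt.
have k_fv : k \in f :\ v by rewrite !inE eq_sym v_neq_k.
by rewrite (leq_trans (min_label_le _ _ _ k_fv))// k_min min_label_le// s_f.
Qed.
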